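(* Consider the plant $x[t+1]=Ax[t]+Bu[t]+\delta_x[t]$, $y[t]=Cx[t]+\delta_y[t]$ in feedback with the dynamic controller $\xi[t+1]=A_k\xi[t]+B_ky[t]$, $u[t]=C_k\xi[t]+D_ky[t]+\delta_u[t]$, and, for a given horizon $T$, the statements: (i) $\boldsymbol{\Phi}\in\mathcal{F}_T$; (ii) the closed-loop transfer matrix from $(\delta_x,\delta_y)$ to $(\mathbf{x},\mathbf{u})$ is in $\mathcal{F}_T$; (iii) the closed-loop transfer matrix from $(\delta_x,\delta_y)$ to $(\mathbf{y},\mathbf{u})$ is in $\mathcal{F}_T$; (iv) the closed-loop transfer matrix from $(\delta_y,\delta_u)$ to $(\mathbf{x},\mathbf{u})$ is in $\mathcal{F}_T$; (v) the closed-loop transfer matrix from $(\delta_y,\delta_u)$ to $(\mathbf{y},\mathbf{u})$ is in $\mathcal{F}_T$. If $(A,B,C)$ and $(A_k,B_k,C_k)$ are both stabilizable and detectable, then (i) $\Leftrightarrow$ (ii) $\Rightarrow$ (iii) $\Rightarrow$ (v) and (i) $\Leftrightarrow$ (ii) $\Rightarrow$ (iv) $\Rightarrow$ (v). In addition, if $(A,B,C)$ and $(A_k,B_k,C_k)$ are both controllable and observable, then (i) $\Leftrightarrow$ (ii) $\Leftrightarrow$ (iii) $\Leftrightarrow$ (iv) $\Leftrightarrow$ (v).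
   Context: All systems are discrete-time, linear time-invariant with real matrices; $x[t]\in\mathbb{R}^n$, $u[t]\in\mathbb{R}^m$, $y[t]\in\mathbb{R}^p$, $\xi[t]\in\mathbb{R}^q$; $\delta_x,\delta_y,\delta_u$ are external disturbances; $\mathbf{K}=C_k(zI-A_k)^{-1}B_k+D_k$. $(A,B,C)$ stabilizable and detectable means $(A,B)$ stabilizable and $(A,C)$ detectable (similarly controllable and observable). $\mathcal{RH}_\infty$ is the set of real-rational proper stable transfer matrices (all poles of modulus $<1$), and $\mathcal{F}_T=\{\mathbf{H}\in\mathcal{RH}_\infty : \mathbf{H}=\sum_{k=0}^T \frac{1}{z^k}H_k\}$ with real matrices $H_k$ (finite impulse response of horizon $T$). The closed-loop responses $\boldsymbol{\Phi}_{ab}$, from $\delta_b$ to signal $\mathbf{a}$ ($a,b\in\{x,y,u\}$), are: $\boldsymbol{\Phi}_{xx}=(zI-A-B\mathbf{K}C)^{-1}$, $\boldsymbol{\Phi}_{xy}=\boldsymbol{\Phi}_{xx}B\mathbf{K}$, $\boldsymbol{\Phi}_{xu}=\boldsymbol{\Phi}_{xx}B$, $\boldsymbol{\Phi}_{yx}=C\boldsymbol{\Phi}_{xx}$, $\boldsymbol{\Phi}_{yy}=C\boldsymbol{\Phi}_{xx}B\mathbf{K}+I$, $\boldsymbol{\Phi}_{yu}=C\boldsymbol{\Phi}_{xx}B$, $\boldsymbol{\Phi}_{ux}=\mathbf{K}C\boldsymbol{\Phi}_{xx}$, $\boldsymbol{\Phi}_{uy}=\mathbf{K}(C\boldsymbol{\Phi}_{xx}B\mathbf{K}+I)$,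 $\boldsymbol{\Phi}_{uu}=\mathbf{K}C\boldsymbol{\Phi}_{xx}B+I$. $\boldsymbol{\Phi}$ is the $3\times3$ block matrix of all $\boldsymbol{\Phi}_{ab}$, and the closed-loop transfer matrix from $(\delta_b,\delta_{b'})$ to $(\mathbf{a},\mathbf{a}')$ is $\begin{bmatrix}\boldsymbol{\Phi}_{ab}&\boldsymbol{\Phi}_{ab'}\\ \boldsymbol{\Phi}_{a'b}&\boldsymbol{\Phi}_{a'b'}\end{bmatrix}$. *)

(* Defs.v *)
From mathcomp Require Import all_boot all_order all_algebra.
From mathcomp Require Import complex reals.

Set Implicit Arguments.
Unset Strict Implicit.
Unset Printing Implicit Defensive.

Import Order.TTheory GRing.Theory Num.Theory.
Local Open Scope ring_scope.

(* The real rational functions R(z), with 'X playing the role of z. *)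
Notation ratfun R := {fraction {poly R}}.

Definition of_poly (R : realType) (p : {poly R}) : ratfun R :=
  FracField.tofrac p.

Definition zvar (R : realType) : ratfun R := of_poly 'X.

Definition cst_mx (R : realType) (m n : nat) (M : 'M[R]_(m, n)) :
    'M[ratfun R]_(m, n) :=
  map_mx (fun a : R => of_poly a%:P) M.

Section StateSpace.
Variable R : realType.

(* All eigenvalues, complex ones included, have modulus < 1. *)
Definition schur_stable (n : nat) (A : 'M[R]_n) : Prop :=
  forall l : R[i], eigenvalue (map_mx (real_complex R) A) l -> `|l| < 1.

Definition stabilizable (n m : nat) (A : 'M[R]_n) (B : 'M[R]_(n, m)) : Prop :=
  exists F : 'M[R]_(m, n), schur_stable (A + B *m F).

Definition detectable (n p : nat) (A : 'M[R]_n) (C : 'M[R]_(p, n)) : Prop :=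
  exists L : 'M[R]_(n, p), schur_stable (A + L *m C).

(* [B, A B, ..., A^(n-1) B] *)
Definition ctrb_mx (n m : nat) (A : 'M[R]_n) (B : 'M[R]_(n, m)) :
    'M[R]_(n, \sum_(k < n) m) :=
  \mxrow_(k < n) (A ^+ k *m B).

(* [C; C A; ...; C A^(n-1)] *)
Definition obsv_mx (n p : nat) (A : 'M[R]_n) (C : 'M[R]_(p, n)) :
    'M[R]_(\sum_(k < n) p, n) :=
  \mxcol_(k < n) (C *m A ^+ k).

Definition controllable (n m : nat) (A : 'M[R]_n) (B : 'M[R]_(n, m)) : Prop :=
  \rank (ctrb_mx A B) = n.

Definition observable (n p : nat) (A : 'M[R]_n) (C : 'M[R]_(p, n)) : Prop :=
  \rank (obsv_mx A C) = n.

End StateSpace.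

Section TransferMatrices.
Variable R : realType.

Definition proper (f : ratfun R) : Prop :=
  exists p q : {poly R},
    [/\ q != 0, f = of_poly p / of_poly q & (size p <= size q)%N].

(* l is a root of the denominator of f written in lowest terms. *)
Definition pole (f : ratfun R) (l : R[i]) : Prop :=
  exists p q : {poly R},
    [/\ q != 0, coprimep p q, f = of_poly p / of_poly q
      & root (map_poly (real_complex R) q) l].

Definition RHinf (m n : nat) (H : 'M[ratfun R]_(m, n)) : Prop :=
  forall i j, proper (H i j) /\ (forall l : R[i], pole (H i j) l -> `|l| < 1).

Definition FIR (T : nat) (m n : nat) (H : 'M[ratfun R]_(m, n)) : Prop :=
  RHinf H /\
  exists Hk : 'I_T.+1 -> 'M[R]_(m, n),
    H = \sum_(k < T.+1) (1 / zvar R ^+ k) *: cst_mx (Hk k).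

Definition transfer (q p m : nat) (Ak : 'M[R]_q) (Bk : 'M[R]_(q, p))
    (Ck : 'M[R]_(m, q)) (Dk : 'M[R]_(m, p)) : 'M[ratfun R]_(m, p) :=
  cst_mx Ck *m invmx ((zvar R)%:M - cst_mx Ak) *m cst_mx Bk + cst_mx Dk.

End TransferMatrices.

Section ClosedLoop.
Variables (R : realType) (n m p : nat).
Variables (A : 'M[R]_n) (B : 'M[R]_(n, m)) (C : 'M[R]_(p, n)).
Variable K : 'M[ratfun R]_(m, p).

Local Notation Az := (cst_mx A).
Local Notation Bz := (cst_mx B).
Local Notation Cz := (cst_mx C).

(* For proper K the inverted matrix is invertible over R(z): its determinant is
   z^n (1 + o(1)) at infinity.  So invmx is a genuine inverse here. *)
Definition Phi_xx : 'M[ratfun R]_n :=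
  invmx ((zvar R)%:M - Az - Bz *m K *m Cz).
Definition Phi_xy : 'M[ratfun R]_(n, p) := Phi_xx *m Bz *m K.
Definition Phi_xu : 'M[ratfun R]_(n, m) := Phi_xx *m Bz.
Definition Phi_yx : 'M[ratfun R]_(p, n) := Cz *m Phi_xx.
Definition Phi_yy : 'M[ratfun R]_p := Cz *m Phi_xx *m Bz *m K + 1%:M.
Definition Phi_yu : 'M[ratfun R]_(p, m) := Cz *m Phi_xx *m Bz.
Definition Phi_ux : 'M[ratfun R]_(m, n) := K *m Cz *m Phi_xx.
Definition Phi_uy : 'M[ratfun R]_(m, p) :=
  K *m (Cz *m Phi_xx *m Bz *m K + 1%:M).
Definition Phi_uu : 'M[ratfun R]_m := K *m Cz *m Phi_xx *m Bz + 1%:M.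

Definition Phi : 'M[ratfun R]_(n + (p + m), n + (p + m)) :=
  col_mx (row_mx Phi_xx (row_mx Phi_xy Phi_xu))
 (col_mx (row_mx Phi_yx (row_mx Phi_yy Phi_yu))
         (row_mx Phi_ux (row_mx Phi_uy Phi_uu))).

(* cl_bb'_aa' is the closed-loop map from (delta_b, delta_b') to (a, a'). *)
Definition cl_xy_xu : 'M[ratfun R]_(n + m, n + p) :=
  block_mx Phi_xx Phi_xy Phi_ux Phi_uy.
Definition cl_xy_yu : 'M[ratfun R]_(p + m, n + p) :=
  block_mx Phi_yx Phi_yy Phi_ux Phi_uy.
Definition cl_yu_xu : 'M[ratfun R]_(n + m, p + m) :=
  block_mx Phi_xy Phi_xu Phi_uy Phi_uu.
Definition cl_yu_yu : 'M[ratfun R]_(p + m, p + m) :=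
  block_mx Phi_yy Phi_yu Phi_uy Phi_uu.

End ClosedLoop.

(* Main.v *)
Require Import Defs.
From mathcomp Require Import all_boot all_order all_algebra.
From mathcomp Require Import complex boolp reals.
From mathcomp Require Import fingroup perm zify.

Set Implicit Arguments.
Unset Strict Implicit.
Unset Printing Implicit Defensive.

Import Order.TTheory GRing.Theory Num.Theory.
Local Open Scope ring_scope.

(** Membership in F_T is an entrywise condition, f = P / z^T with P a polynomial
of degree at most T, and is preserved by sums and by products with real
matrices; this gives every implication that starts from a larger set of
responses.  For the converses, the states satisfy z Phi_xb = A Phi_xb +
B Phi_ub (+ I), and since Phi_xb is strictly proper, multiplying C A^k Phi_xb
by z does not leave F_T.  Hence C A^(k+1) Phi_xb = z C A^k Phi_xb - C A^k (...)
is in F_T for all k, and observability recovers Phi_xb.  Controllability is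
dual. *)

(** * Scalar rational functions: order at infinity and finite impulse responses *)

Section ScalarRationalFunctions.
Variable R : realType.
Implicit Types (f g : ratfun R) (P Q : {poly R}) (T : nat).

Let z : ratfun R := zvar R.

Lemma of_poly_eq0 P : (of_poly P == 0) = (P == 0).
Proof. exact: tofrac_eq0. Qed.

Lemma of_polyM P Q : of_poly (P * Q) = of_poly P * of_poly Q.
Proof. exact: rmorphM. Qed.

Lemma of_polyD P Q : of_poly (P + Q) = of_poly P + of_poly Q.
Proof. exact: rmorphD. Qed.

Lemma of_polyXn k : of_poly 'X^k = z ^+ k.
Proof. exact: rmorphXn. Qed.

Lemma zvar_neq0 : z != 0.
Proof. by rewrite of_poly_eq0 polyX_eq0. Qed.

Lemma of_poly_div_eq P Q P' Q' : Q != 0 -> Q' != 0 ->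
  of_poly P / of_poly Q = of_poly P' / of_poly Q' -> P * Q' = P' * Q.
Proof.
move=> Q0 Q0' /eqP; rewrite eqr_div ?of_poly_eq0 // -!of_polyM.
by rewrite /of_poly tofrac_eq => /eqP.
Qed.

(* size_mul with the structures inferred from R : realType, without which lia
does not identify the sizes. *)
Lemma size_mulR P Q : P != 0 -> Q != 0 -> size (P * Q) = (size P + size Q).-1.
Proof. exact: size_mul. Qed.

(* f has a zero of order at least d at infinity: d = 0 is properness, d = 1
strict properness. *)
Definition zero_infty (d : nat) f := exists P Q,
  [/\ Q != 0, f = of_poly P / of_poly Q & (size P + d <= size Q)%N].

Lemma zero_inftyW d e f : (e <= d)%N -> zero_infty d f -> zero_infty e f.
Proof.
move=> ed [P [Q [Q0 -> PQ]]]; exists P, Q; split=> //.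
by rewrite (leq_trans _ PQ) ?leq_add2l.
Qed.

Lemma zero_infty_of_poly d P : (size P + d <= 1)%N -> zero_infty d (of_poly P).
Proof.
by exists P, 1; rewrite oner_neq0 size_poly1 /of_poly tofrac1 divr1.
Qed.

Lemma zero_infty0 d : zero_infty d 0.
Proof.
(* The fraction 0/1 meets the size bound only for [d <= 1], hence the denominator ['X^d]. *)
exists 0, 'X^d; rewrite monic_neq0 ?monicXn // size_poly0 size_polyXn leqnSn.
by rewrite /of_poly tofrac0 mul0r.
Qed.

Lemma zero_infty_const (a : R) : zero_infty 0 (of_poly a%:P).
Proof. by apply: zero_infty_of_poly; rewrite addn0 size_polyC_leq1. Qed.

Lemma zero_infty1 : zero_infty 0 1.
Proof. by rewrite -[1]tofrac1; apply: zero_infty_const. Qed.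

Lemma zero_inftyV : zero_infty 1 z^-1.
Proof.
exists 1, 'X; rewrite polyX_eq0 size_poly1 size_polyX /of_poly tofrac1.
by rewrite mul1r.
Qed.

Lemma zero_inftyD d f g : zero_infty d f -> zero_infty d g -> zero_infty d (f + g).
Proof.
move=> [P [Q [Q0 -> PQ]]] [P' [Q' [Q0' -> PQ']]].
exists (P * Q' + P' * Q), (Q * Q'); split; first by rewrite mulf_neq0.
  by rewrite addf_div ?of_poly_eq0 // of_polyD !of_polyM.
rewrite (size_mulR Q0 Q0').
have bound (p q q' : {poly R}) : q' != 0 -> (size p + d <= size q)%N ->
    (size (p * q')%R + d <= (size q + size q').-1)%N.
  rewrite -size_poly_gt0 => q0' pq.
  (* The size formula for products fails at [p = 0]; there [d <= size q] and [0 < size q']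
     suffice. *)
  have [->|p0] := eqVneq p 0; first by rewrite mul0r size_poly0; lia.
  rewrite size_mulR ?p0 -?size_poly_gt0 //.
  by move: p0; rewrite -size_poly_gt0; lia.
apply: leq_trans (leq_add (size_polyD _ _) (leqnn d)) _.
by rewrite addn_maxl geq_max bound // (addnC (size Q)) bound.
Qed.

Lemma zero_inftyM d e f g :
  zero_infty d f -> zero_infty e g -> zero_infty (d + e) (f * g).
Proof.
move=> [P [Q [Q0 -> PQ]]] [P' [Q' [Q0' -> PQ']]].
have [->|P0] := eqVneq P 0.
  by rewrite /of_poly tofrac0 !mul0r; apply: zero_infty0.
have [->|P0'] := eqVneq P' 0.
  by rewrite /of_poly tofrac0 mul0r mulr0; apply: zero_infty0.
exists (P * P'), (Q * Q'); split; first by rewrite mulf_neq0.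
  by rewrite !of_polyM mulf_div.
rewrite (size_mulR P0 P0') (size_mulR Q0 Q0').
by move: P0 P0'; rewrite -!size_poly_gt0; lia.
Qed.

Lemma zero_infty_opp d f : zero_infty d f -> zero_infty d (- f).
Proof.
move=> [P [Q [Q0 -> PQ]]]; exists (- P), Q; rewrite size_polyN; split=> //.
by rewrite /of_poly tofracN mulNr.
Qed.

Lemma zero_infty_sum d (I : Type) (r : seq I) (p : pred I) (F : I -> ratfun R) :
  (forall i, p i -> zero_infty d (F i)) ->
  zero_infty d (\sum_(i <- r | p i) F i).
Proof.
move=> Fd; elim/big_ind: _ => //; first exact: zero_infty0.
exact: zero_inftyD.
Qed.

Lemma zero_infty_prod (I : Type) (r : seq I) (p : pred I) (F : I -> ratfun R) :
  (forall i, p i -> zero_infty 0 (F i)) ->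
  zero_infty 0 (\prod_(i <- r | p i) F i).
Proof.
move=> F0; elim/big_ind: _ => //; first exact: zero_infty1.
exact: zero_inftyM.
Qed.

Lemma zero_infty_sign k : zero_infty 0 ((-1) ^+ k).
Proof.
elim: k => [|k IHk]; first exact: zero_infty1.
by rewrite exprS mulN1r; apply: zero_infty_opp.
Qed.

(** If f - 1 = P/Q with deg P < deg Q, then f = (P + Q)/Q has numerator and denominator of equal
    degree. *)
Lemma unit_infty f : zero_infty 1 (f - 1) -> f != 0 /\ zero_infty 0 f^-1.
Proof.
move=> [P [Q [Q0 fE PQ]]].
have sPQ : size (P + Q) = size Q by rewrite addrC size_polyDl // -addn1.
have PQ0 : P + Q != 0 by rewrite -size_poly_gt0 sPQ size_poly_gt0.
have {}fE : f = of_poly (P + Q) / of_poly Q.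
  by rewrite of_polyD mulrDl divff ?of_poly_eq0 // -fE subrK.
split; first by rewrite fE mulf_neq0 ?invr_eq0 ?of_poly_eq0.
by exists Q, (P + Q); rewrite fE invf_div sPQ addn0.
Qed.

(** Common-denominator form of an expansion in 1/z up to order [T], suited to degree and
    divisibility arguments. *)
Definition fir T f :=
  exists2 P : {poly R}, (size P <= T.+1)%N & f = of_poly P / of_poly 'X^T.

Lemma fir0 T : fir T 0.
Proof. by exists 0; rewrite ?size_poly0 // /of_poly tofrac0 mul0r. Qed.

Lemma fir1 T : fir T 1.
Proof.
by exists 'X^T; rewrite ?size_polyXn // divff // of_poly_eq0 monic_neq0 ?monicXn.
Qed.

Lemma firD T f g : fir T f -> fir T g -> fir T (f + g).
Proof.
move=> [P sP ->] [Q sQ ->]; exists (P + Q); last by rewrite of_polyD mulrDl.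
by rewrite (leq_trans (size_polyD _ _)) // geq_max sP sQ.
Qed.

Lemma fir_const_mul T (a : R) f : fir T f -> fir T (of_poly a%:P * f).
Proof.
move=> [P sP ->]; exists (a%:P * P); last by rewrite of_polyM mulrA.
by rewrite mul_polyC (leq_trans (size_scale_leq _ _)).
Qed.

Lemma firN T f : fir T f -> fir T (- f).
Proof.
move=> [P sP ->]; exists (- P); first by rewrite size_polyN.
by rewrite /of_poly tofracN mulNr.
Qed.

Lemma fir_sum T (I : Type) (r : seq I) (p : pred I) (F : I -> ratfun R) :
  (forall i, p i -> fir T (F i)) -> fir T (\sum_(i <- r | p i) F i).
Proof. by move=> FT; apply: (big_ind (fir T) (fir0 T) (@firD T)). Qed.

(** Comparing degrees in [P * Q = P' * 'X^T], strict properness of P'/Q forces deg P < T, which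
    leaves room for one more factor z. *)
Lemma fir_mulz T f : fir T f -> zero_infty 1 f -> fir T (z * f).
Proof.
move=> [P sP fE] [P' [Q [Q0 fE' PQ]]].
exists ('X * P); last by rewrite fE mulrA of_polyM.
have XT0 : 'X^T != 0 :> {poly R} by rewrite monic_neq0 ?monicXn.
have := of_poly_div_eq XT0 Q0 (etrans (esym fE) fE').
have [-> _|P0] := eqVneq P 0; first by rewrite mulr0 size_poly0.
have [->|P0'] := eqVneq P' 0.
  by rewrite mul0r => /eqP; rewrite mulf_eq0 (negPf P0) (negPf Q0).
move=> /(congr1 (fun p : {poly R} => size p)).
rewrite -commr_polyX size_mulX // (size_mulR P0 Q0).
rewrite (size_mulR P0' XT0) size_polyXn.
have : (0 < size P)%N by rewrite size_poly_gt0.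
lia.
Qed.

Lemma fir_sum_powers T f :
  fir T f <->
  exists a : 'I_T.+1 -> R, f = \sum_(k < T.+1) 1 / z ^+ k * of_poly (a k)%:P.
Proof.
have z0 := zvar_neq0.
have term (a : R) (k : 'I_T.+1) : 1 / z ^+ k * of_poly a%:P =
    of_poly (a *: 'X^(T - k)) / of_poly 'X^T.
  rewrite -mul_polyC of_polyM !of_polyXn mul1r mulrC -mulrA; congr (_ * _).
  rewrite -[in z ^+ T](subnK (ltnSE (ltn_ord k))) exprD invfM.
  by rewrite mulVKf ?expf_neq0.
split=> [[P sP ->]|[a ->]].
  (* Since z^(-k) = z^(T-k) / z^T, the coefficients of [P] are read in reverse order. *)
  exists (fun k => P`_(T - k)).
  under eq_bigr do rewrite term.
  rewrite -mulr_suml /of_poly -rmorph_sum; congr (FracField.tofrac _ / _).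
  rewrite (reindex_inj rev_ord_inj) /=.
  apply/polyP => i; rewrite coef_sum.
  under eq_bigr => k _ do rewrite subSS subKn ?(ltnSE (ltn_ord k)) // coefZ coefXn.
  have [iT|iT] := ltnP i T.+1; last first.
    rewrite nth_default ?(leq_trans sP) // big1 // => k _.
    by rewrite gtn_eqF ?mulr0 // (leq_trans (ltn_ord k)).
  rewrite (bigD1 (Ordinal iT)) //= eqxx mulr1 big1 ?addr0 // => k.
  by rewrite -val_eqE /= eq_sym => /negPf ->; rewrite mulr0.
apply: fir_sum => k _; exists (a k *: 'X^(T - k)); last by rewrite term.
by rewrite (leq_trans (size_scale_leq _ _)) // size_polyXn ltnS leq_subr.
Qed.

(** A denominator in lowest terms divides z^T, so 0 is the only possible pole. *)
Lemma fir_RHinf T f :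
  fir T f -> Defs.proper f /\ forall l : R[i], pole f l -> `|l| < 1.
Proof.
have XT0 : 'X^T != 0 :> {poly R} by rewrite monic_neq0 ?monicXn.
move=> [P sP fE]; split; first by exists P, 'X^T; rewrite size_polyXn.
move=> l [p [q [q0 pq fE' ql]]].
(* Cross-multiplying gives [P * q = p * 'X^T], and [q] is coprime to [p]. *)
have qX : q %| 'X^T.
  have := of_poly_div_eq XT0 q0 (etrans (esym fE) fE') => /(congr1 (dvdp q)).
  by rewrite dvdp_mulIr Gauss_dvdpr // coprimep_sym.
have : root (map_poly (real_complex R) 'X^T) l.
  move: qX; rewrite -(dvdp_map (real_complex R)) => /dvdpP[s ->].
  by rewrite rootM ql orbT.
rewrite map_polyXn rootE hornerXn expf_eq0 => /andP[_ /eqP ->].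
by rewrite normr0 ltr01.
Qed.

End ScalarRationalFunctions.

(** * Matrices of rational functions: entrywise conditions, resolvents, and recovery of a state
    response *)

Section MatrixRationalFunctions.
Variable R : realType.

Local Notation z := (zvar R).

Definition mxfir T m n (H : 'M[ratfun R]_(m, n)) := forall i j, fir T (H i j).

Definition mxzero_infty d m n (H : 'M[ratfun R]_(m, n)) :=
  forall i j, zero_infty d (H i j).

Lemma FIR_mxfir T m n (H : 'M[ratfun R]_(m, n)) : FIR T H <-> mxfir T H.
Proof.
split=> [[_ [Hk HE]] i j|HT].
  apply/fir_sum_powers; exists (fun k => Hk k i j).
  by rewrite HE summxE; apply: eq_bigr => k _; rewrite !mxE.
split; first by move=> i j; apply: fir_RHinf (HT i j).
(* Choice selects the coefficients of all entries at once, so that they assemble into the matrices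
   [Hk]. *)
have [a aE] := choice (fun ij : 'I_m * 'I_n =>
  (fir_sum_powers T (H ij.1 ij.2)).1 (HT ij.1 ij.2)).
exists (fun k => \matrix_(i, j) a (i, j) k); apply/matrixP => i j.
by rewrite (aE (i, j)) summxE; apply: eq_bigr => k _; rewrite !mxE.
Qed.

Lemma cst_mxM m n p (M : 'M[R]_(m, n)) (N : 'M[R]_(n, p)) :
  cst_mx (M *m N) = cst_mx M *m cst_mx N.
Proof. exact: (map_mxM (@FracField.tofrac _ \o @polyC R)). Qed.

Lemma cst_mx1 n : cst_mx (1%:M : 'M[R]_n) = 1%:M.
Proof. exact: (map_mx1 (@FracField.tofrac _ \o @polyC R)). Qed.

Lemma cst_mx_tr m n (M : 'M[R]_(m, n)) : (cst_mx M)^T = cst_mx M^T.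
Proof. by apply/matrixP => i j; rewrite !mxE. Qed.

Lemma mxzero_infty_cst m n (M : 'M[R]_(m, n)) : mxzero_infty 0 (cst_mx M).
Proof. by move=> i j; rewrite mxE; apply: zero_infty_const. Qed.

Lemma mxzero_inftyM d e m n p (M : 'M[ratfun R]_(m, n)) (N : 'M[ratfun R]_(n, p)) :
  mxzero_infty d M -> mxzero_infty e N -> mxzero_infty (d + e) (M *m N).
Proof.
move=> Md Ne i j; rewrite mxE; apply: zero_infty_sum => k _.
exact: zero_inftyM.
Qed.

Lemma mxzero_inftyD d m n (M N : 'M[ratfun R]_(m, n)) :
  mxzero_infty d M -> mxzero_infty d N -> mxzero_infty d (M + N).
Proof. by move=> Md Nd i j; rewrite mxE; apply: zero_inftyD. Qed.

Lemma mxfirD T m n (M N : 'M[ratfun R]_(m, n)) :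
  mxfir T M -> mxfir T N -> mxfir T (M + N).
Proof. by move=> MT NT i j; rewrite mxE; apply: firD. Qed.

Lemma mxfirN T m n (M : 'M[ratfun R]_(m, n)) : mxfir T M -> mxfir T (- M).
Proof. by move=> MT i j; rewrite mxE; apply: firN. Qed.

Lemma mxfir1 T n : mxfir T (1%:M : 'M[ratfun R]_n).
Proof. by move=> i j; rewrite mxE; case: (i == j); [apply: fir1|apply: fir0]. Qed.

Lemma mxfir_addr1 T n (M : 'M[ratfun R]_n) : mxfir T (M + 1%:M) -> mxfir T M.
Proof.
move=> MT; rewrite -[M](addrK 1%:M).
exact: (mxfirD MT (mxfirN (@mxfir1 T n))).
Qed.

Lemma mxfir_cstl T m n p (M : 'M[R]_(m, n)) (H : 'M[ratfun R]_(n, p)) :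
  mxfir T H -> mxfir T (cst_mx M *m H).
Proof.
move=> HT i j; rewrite mxE; apply: fir_sum => k _.
by rewrite mxE; apply: fir_const_mul.
Qed.

Lemma mxfir_tr T m n (H : 'M[ratfun R]_(m, n)) : mxfir T H^T <-> mxfir T H.
Proof. by split=> HT i j; have := HT j i; rewrite mxE. Qed.

Lemma mxfir_cstr T m n p (M : 'M[R]_(n, p)) (H : 'M[ratfun R]_(m, n)) :
  mxfir T H -> mxfir T (H *m cst_mx M).
Proof.
move=> HT; apply/mxfir_tr; rewrite trmx_mul cst_mx_tr.
by apply: mxfir_cstl; apply/mxfir_tr.
Qed.

Lemma mxfir_row T m n1 n2 (H1 : 'M[ratfun R]_(m, n1)) (H2 : 'M_(m, n2)) :
  mxfir T (row_mx H1 H2) <-> mxfir T H1 /\ mxfir T H2.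
Proof.
split=> [HT|[H1T H2T] i j]; last by rewrite mxE; case: split.
split=> i j.
  by have := HT i (lshift n2 j); rewrite row_mxEl.
by have := HT i (rshift n1 j); rewrite row_mxEr.
Qed.

Lemma mxfir_col T m1 m2 n (H1 : 'M[ratfun R]_(m1, n)) (H2 : 'M_(m2, n)) :
  mxfir T (col_mx H1 H2) <-> mxfir T H1 /\ mxfir T H2.
Proof. by rewrite -mxfir_tr tr_col_mx mxfir_row !mxfir_tr. Qed.

Lemma mxfir_block T m1 m2 n1 n2 (H11 : 'M[ratfun R]_(m1, n1))
    (H12 : 'M_(m1, n2)) (H21 : 'M_(m2, n1)) (H22 : 'M_(m2, n2)) :
  mxfir T (block_mx H11 H12 H21 H22) <->
  (mxfir T H11 /\ mxfir T H12) /\ (mxfir T H21 /\ mxfir T H22).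
Proof. by rewrite mxfir_col !mxfir_row. Qed.

Lemma zero_infty_det n (M : 'M[ratfun R]_n) :
  mxzero_infty 0 M -> zero_infty 0 (\det M).
Proof.
move=> M0; apply: zero_infty_sum => s _; apply: (@zero_inftyM _ 0 0).
  exact: zero_infty_sign.
exact: zero_infty_prod.
Qed.

Lemma zero_infty_prod_sub1 (I : Type) (r : seq I) (F : I -> ratfun R) :
  (forall i, zero_infty 1 (F i - 1)) -> zero_infty 1 (\prod_(i <- r) F i - 1).
Proof.
move=> F1; elim/big_ind: _ => [|x y x1 y1|i _] //.
  by rewrite subrr; apply: zero_infty0.
(* Here x - 1 and y - 1 are strictly proper and y is proper, so both summands are strictly
   proper. *)
have -> : x * y - 1 = (x - 1) * y + (y - 1).
  by rewrite mulrBl mul1r addrA subrK.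
apply: zero_inftyD => //; apply: (@zero_inftyM _ 1 0) => //.
rewrite -[y](subrK 1); apply: zero_inftyD; last exact: zero_infty1.
exact: zero_inftyW y1.
Qed.

(** In the Leibniz expansion the identity permutation contributes a product of factors 1 - N_ii. Any
    other permutation moves some i and so contributes a strictly proper off-diagonal factor. *)
Lemma zero_infty_det_1sub n (N : 'M[ratfun R]_n) :
  mxzero_infty 1 N -> zero_infty 1 (\det (1%:M - N) - 1).
Proof.
move=> N1; rewrite /determinant (bigD1 1%g) //= odd_perm1 expr0 mul1r addrAC.
have N0 : mxzero_infty 0 (1%:M - N).
  move=> i j; rewrite !mxE; apply: zero_inftyD; last first.
    by apply/zero_infty_opp/(zero_inftyW _ (N1 i j)).
  by case: (i == j); [apply: zero_infty1|apply: zero_infty0].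
apply: zero_inftyD.
  apply: zero_infty_prod_sub1 => i.
  rewrite perm1 !mxE eqxx addrAC subrr add0r.
  exact/zero_infty_opp.
apply: zero_infty_sum => s s1; apply: (@zero_inftyM _ 0 1).
  exact: zero_infty_sign.
have /existsP[i si] : [exists i, s i != i].
  apply: contraNT s1 => /existsPn sid; apply/eqP/permP => i.
  by rewrite perm1; apply/eqP; rewrite -[_ == _]negbK.
rewrite (bigD1 i) //=; apply: (@zero_inftyM _ 1 0); last exact: zero_infty_prod.
rewrite !mxE eq_sym (negPf si) sub0r; exact/zero_infty_opp.
Qed.

(** Write zI - M = zE with E = I - M/z. The determinant of E is 1 plus a strictly proper term, so E
    has a proper inverse; the factor 1/z makes the resolvent strictly proper. This gives
    well-posedness of the loop. *)
Lemma resolvent_infty n (M : 'M[ratfun R]_n) : mxzero_infty 0 M ->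
  z%:M - M \in unitmx /\ mxzero_infty 1 (invmx (z%:M - M)).
Proof.
move=> M0; pose E := 1%:M - z^-1 *: M.
have zME : z%:M - M = z *: E.
  by rewrite scalerBr scalemx1 scalerA divff ?zvar_neq0 // scale1r.
have N1 : mxzero_infty 1 (z^-1 *: M).
  by move=> i j; rewrite mxE; apply: (@zero_inftyM _ 1 0) => //; apply: zero_inftyV.
have E0 : mxzero_infty 0 E.
  move=> i j; rewrite !mxE; apply: zero_inftyD.
    by case: (i == j); [apply: zero_infty1|apply: zero_infty0].
  by apply/zero_infty_opp; have := N1 i j; rewrite mxE; apply: zero_inftyW.
have [detE0 detEV] := unit_infty (zero_infty_det_1sub N1).
have Eu : E \in unitmx by rewrite unitmxE unitfE.
have zE1 : z *: E *m (z^-1 *: invmx E) = 1%:M.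
  by rewrite -scalemxAl -scalemxAr scalerA divff ?zvar_neq0 // scale1r mulmxV.
have [zEu _] := mulmx1_unit zE1.
rewrite zME; split=> // i j; rewrite -[invmx _]mulmx1 -zE1 mulKmx // mxE.
apply: (@zero_inftyM _ 1 0); first exact: zero_inftyV.
(* The inverse of [E] is its adjugate over its determinant; cofactors of a proper matrix are
   proper. *)
rewrite /invmx Eu mxE; apply: (@zero_inftyM _ 0 0) => //.
rewrite mxE; apply: (@zero_inftyM _ 0 0).
  exact: zero_infty_sign.
by apply: zero_infty_det => k l; rewrite 2!mxE.
Qed.

Lemma transfer_infty q p m (Ak : 'M[R]_q) (Bk : 'M[R]_(q, p))
    (Ck : 'M[R]_(m, q)) (Dk : 'M[R]_(m, p)) :
  mxzero_infty 0 (transfer Ak Bk Ck Dk).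
Proof.
have [_ rk] := resolvent_infty (mxzero_infty_cst Ak).
apply: mxzero_inftyD; last exact: mxzero_infty_cst.
apply: (@mxzero_inftyM 0 0); last exact: mxzero_infty_cst.
apply: (@mxzero_inftyM 0 0); first exact: mxzero_infty_cst.
by move=> i j; apply: zero_inftyW (rk i j).
Qed.

(** [X] plays a state response to the input term [Y]. Induction on k puts each C A^k X in F_T, and a
    left inverse of the observability matrix recovers [X]. *)
Lemma mxfir_observable T n p r (A : 'M[R]_n) (C : 'M[R]_(p, n))
    (X Y : 'M[ratfun R]_(n, r)) :
  observable A C -> mxzero_infty 1 X -> z *: X = cst_mx A *m X + Y ->
  mxfir T Y -> mxfir T (cst_mx C *m X) -> mxfir T X.
Proof.
move=> /eqP obs X1 zX YT CXT.
have CAXT k : mxfir T (cst_mx (C *m A ^+ k) *m X).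
  elim: k => [|k IHk]; first by rewrite expr0 mulmx1.
  have -> : cst_mx (C *m A ^+ k.+1) *m X =
      z *: (cst_mx (C *m A ^+ k) *m X) - cst_mx (C *m A ^+ k) *m Y.
    rewrite exprSr mulmxA cst_mxM -mulmxA scalemxAr zX mulmxDr addrK.
    by [].
  apply: mxfirD; last exact/mxfirN/mxfir_cstl.
  move=> i j; rewrite mxE; apply: fir_mulz => //.
  exact: (@mxzero_inftyM 0 1 _ _ _ _ _ (mxzero_infty_cst _) X1).
have /row_fullP[L LO] : row_full (obsv_mx A C) by [].
rewrite -[X]mul1mx -cst_mx1 -LO cst_mxM -mulmxA; apply: mxfir_cstl => i j.
(* Row [i] of the stacked product is row [tagnat.sig2 i] of the block with index [tagnat.sig1 i]. *)
rewrite (_ : (_ *m _) i j =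
  (cst_mx (C *m A ^+ tagnat.sig1 i) *m X) (tagnat.sig2 i) j); first exact: CAXT.
rewrite [LHS]mxE [RHS]mxE; apply: eq_bigr => k _; congr (_ * _).
by rewrite [LHS]mxE [RHS]mxE /obsv_mx mxE.
Qed.

Lemma controllable_tr n m (A : 'M[R]_n) (B : 'M[R]_(n, m)) :
  controllable A B -> observable A^T B^T.
Proof.
rewrite /controllable /observable -mxrank_tr tr_mxrow => rk.
rewrite -[RHS]rk; congr (\rank _); apply: eq_mxcol => k.
rewrite trmx_mul; congr (_ *m _).
elim: (val k) => [|l IHl]; first by rewrite !expr0 trmx1.
by rewrite [LHS]exprS IHl exprSr; apply/esym/trmx_mul.
Qed.

(** Duality: [X^T] and [Y^T] satisfy the hypotheses of [mxfir_observable] for the pair [A^T],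
    [B^T]. *)
Lemma mxfir_controllable T n m r (A : 'M[R]_n) (B : 'M[R]_(n, m))
    (X Y : 'M[ratfun R]_(r, n)) :
  controllable A B -> mxzero_infty 1 X -> z *: X = X *m cst_mx A + Y ->
  mxfir T Y -> mxfir T (X *m cst_mx B) -> mxfir T X.
Proof.
move=> /controllable_tr obs X1 zX YT XBT; apply/mxfir_tr.
apply: (mxfir_observable obs (Y := Y^T)); last 2 first.
- exact/mxfir_tr.
- by rewrite -cst_mx_tr -trmx_mul; apply/mxfir_tr.
- by move=> i j; rewrite mxE.
- by rewrite -linearZ /= zX linearD /= trmx_mul cst_mx_tr.
Qed.

End MatrixRationalFunctions.

(** * Closed-loop responses: strict properness and recursions in z *)

Section ClosedLoopResponses.
Variables (R : realType) (n m p : nat).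
Variables (A : 'M[R]_n) (B : 'M[R]_(n, m)) (C : 'M[R]_(p, n)).
Variable K : 'M[ratfun R]_(m, p).
Hypothesis K_proper : mxzero_infty 0 K.

Local Notation z := (zvar R).
Local Notation Pxx := (Phi_xx A B C K).
Local Notation Pxy := (Phi_xy A B C K).
Local Notation Pxu := (Phi_xu A B C K).
Local Notation Pux := (Phi_ux A B C K).
Local Notation Puy := (Phi_uy A B C K).
Local Notation Puu := (Phi_uu A B C K).

(** The loop with the controller eliminated; [Phi_xx] is the resolvent of this proper matrix. *)
Let M := cst_mx A + cst_mx B *m K *m cst_mx C.

Let M_proper : mxzero_infty 0 M.
Proof.
apply: mxzero_inftyD; first exact: mxzero_infty_cst.
apply: (@mxzero_inftyM _ 0 0); last exact: mxzero_infty_cst.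
by apply: (@mxzero_inftyM _ 0 0); first exact: mxzero_infty_cst.
Qed.

Let Pxx_M : Pxx = invmx (z%:M - M).
Proof. by rewrite /Phi_xx opprD addrA. Qed.

Lemma Phi_xx_infty : mxzero_infty 1 Pxx.
Proof. by rewrite Pxx_M; have [] := resolvent_infty M_proper. Qed.

Lemma Phi_xy_infty : mxzero_infty 1 Pxy.
Proof.
apply: (@mxzero_inftyM _ 1 0) => //; apply: (@mxzero_inftyM _ 1 0).
  exact: Phi_xx_infty.
exact: mxzero_infty_cst.
Qed.

Lemma Phi_xu_infty : mxzero_infty 1 Pxu.
Proof.
apply: (@mxzero_inftyM _ 1 0); first exact: Phi_xx_infty.
exact: mxzero_infty_cst.
Qed.

Lemma Phi_ux_infty : mxzero_infty 1 Pux.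
Proof.
apply: (@mxzero_inftyM _ 0 1); last exact: Phi_xx_infty.
apply: (@mxzero_inftyM _ 0 0) => //; exact: mxzero_infty_cst.
Qed.

(** This expands (zI - M) Phi_xx = I; the dual form below expands Phi_xx (zI - M) = I. *)
Lemma z_Phi_xx : z *: Pxx = cst_mx A *m Pxx + (cst_mx B *m Pux + 1%:M).
Proof.
have [u _] := resolvent_infty M_proper.
have := mulmxV u; rewrite -Pxx_M mulmxBl mul_scalar_mx => /eqP.
by rewrite subr_eq addrC mulmxDl -!mulmxA !mulmxA -addrA => /eqP.
Qed.

Lemma z_Phi_xx_dual : z *: Pxx = Pxx *m cst_mx A + (Pxy *m cst_mx C + 1%:M).
Proof.
have [u _] := resolvent_infty M_proper.
have := mulVmx u; rewrite -Pxx_M mulmxBr mul_mx_scalar => /eqP.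
by rewrite subr_eq addrC mulmxDr !mulmxA -addrA => /eqP.
Qed.

(** Right multiplication of [z_Phi_xx] by B, which turns Phi_ux B + I into Phi_uu. *)
Lemma z_Phi_xu : z *: Pxu = cst_mx A *m Pxu + cst_mx B *m Puu.
Proof.
rewrite /Phi_xu scalemxAl z_Phi_xx !mulmxDl mul1mx /Phi_uu mulmxDr mulmx1.
by rewrite !mulmxA.
Qed.

(** Right multiplication of [z_Phi_xu] by K, since Phi_uu K = Phi_uy. *)
Lemma z_Phi_xy : z *: Pxy = cst_mx A *m Pxy + cst_mx B *m Puy.
Proof.
rewrite /Phi_xy -/Pxu scalemxAl z_Phi_xu mulmxDl -!mulmxA; congr (_ + _ *m _).
by rewrite /Phi_uu mulmxDl mul1mx /Phi_uy mulmxDr mulmx1 !mulmxA.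
Qed.

(** Left multiplication of [z_Phi_xx_dual] by K C. *)
Lemma z_Phi_ux : z *: Pux = Pux *m cst_mx A + Puy *m cst_mx C.
Proof.
rewrite /Phi_ux scalemxAr z_Phi_xx_dual !mulmxDr mulmx1 /Phi_uy mulmxDr mulmx1.
by rewrite mulmxDl !mulmxA.
Qed.

End ClosedLoopResponses.

(** * Implications between the five closed-loop conditions *)

Theorem theorem2 (R : realType) (n m p q T : nat)
    (A : 'M[R]_n) (B : 'M[R]_(n, m)) (C : 'M[R]_(p, n))
    (Ak : 'M[R]_q) (Bk : 'M[R]_(q, p)) (Ck : 'M[R]_(m, q)) (Dk : 'M[R]_(m, p)) :
  let K := transfer Ak Bk Ck Dk in
  let i := FIR T (Phi A B C K) in
  let ii := FIR T (cl_xy_xu A B C K) in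
  let iii := FIR T (cl_xy_yu A B C K) in
  let iv := FIR T (cl_yu_xu A B C K) in
  let v := FIR T (cl_yu_yu A B C K) in
  ((stabilizable A B /\ detectable A C) /\
   (stabilizable Ak Bk /\ detectable Ak Ck) ->
   [/\ i <-> ii, ii -> iii, iii -> v, ii -> iv & iv -> v]) /\
  ((controllable A B /\ observable A C) /\
   (controllable Ak Bk /\ observable Ak Ck) ->
   [/\ i <-> ii, ii <-> iii, iii <-> iv & iv <-> v]).
Proof.
move=> K i ii iii iv v.
have KP : mxzero_infty 0 K by apply: transfer_infty.
have i_ii : i <-> ii.
  rewrite /i /ii !FIR_mxfir mxfir_block !mxfir_col !mxfir_row.
  split=> [[[xx [xy _]] [_ [ux [uy _]]]]|[[xx xy] [ux uy]]] //.
  (* The other five responses are xx B, C xx, C xx B, ux B + I and C xy + I. *)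
  have xu : mxfir T (Phi_xu A B C K) by apply: mxfir_cstr.
  have yx : mxfir T (Phi_yx A B C K) by apply: mxfir_cstl.
  have yu : mxfir T (Phi_yu A B C K) by apply: mxfir_cstr.
  have uu : mxfir T (Phi_uu A B C K).
    by apply: mxfirD; [apply: mxfir_cstr|apply: mxfir1].
  have yy : mxfir T (Phi_yy A B C K).
    apply: mxfirD; last exact: mxfir1.
    by rewrite -!mulmxA; apply: mxfir_cstl; rewrite !mulmxA.
  by [].
have ii_iii : ii -> iii.
  rewrite -i_ii /i /iii !FIR_mxfir mxfir_block !mxfir_col !mxfir_row.
  by case=> _ [] [? [? _]] [? [? _]].
have ii_iv : ii -> iv.
  rewrite -i_ii /i /iv !FIR_mxfir mxfir_block !mxfir_col !mxfir_row.
  by case=> -[_ [? ?]] [_ [_ [? ?]]].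
have iii_v : iii -> v.
  rewrite /iii /v !FIR_mxfir !mxfir_block => -[[yx yy] [ux uy]].
  split; split=> //; first exact: mxfir_cstr.
  by apply: mxfirD; [apply: mxfir_cstr|apply: mxfir1].
have iv_v : iv -> v.
  rewrite /iv /v !FIR_mxfir !mxfir_block => -[[xy xu] [uy uu]].
  split; split=> //; last by rewrite /Phi_yu -mulmxA; apply: mxfir_cstl.
  apply: mxfirD; last exact: mxfir1.
  by rewrite -!mulmxA; apply: mxfir_cstl; rewrite !mulmxA.
split=> [_|[[ctrb obs] _]]; first by split.
(* Observability recovers Phi_xy from C Phi_xy = Phi_yy - I, and Phi_xu from C Phi_xu = Phi_yu. *)
have v_iv : v -> iv.
  rewrite /iv /v !FIR_mxfir !mxfir_block => -[[yy yu] [uy uu]].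
  split; split=> //.
    apply: (mxfir_observable obs (Phi_xy_infty _ _ _ KP) (z_Phi_xy _ _ _ KP)).
      exact: mxfir_cstl.
    by rewrite !mulmxA; apply: mxfir_addr1.
  apply: (mxfir_observable obs (Phi_xu_infty _ _ _ KP) (z_Phi_xu _ _ _ KP)).
    exact: mxfir_cstl.
  by rewrite !mulmxA.
(* Controllability recovers Phi_xx from Phi_xx B = Phi_xu, and Phi_ux from Phi_ux B = Phi_uu - I. *)
have iv_ii : iv -> ii.
  rewrite /iv /ii !FIR_mxfir !mxfir_block => -[[xy xu] [uy uu]].
  split; split=> //.
    apply: (mxfir_controllable ctrb (Phi_xx_infty _ _ _ KP)
      (z_Phi_xx_dual _ _ _ KP)) => //.
    by apply: mxfirD; [apply: mxfir_cstr|apply: mxfir1].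
  apply: (mxfir_controllable ctrb (Phi_ux_infty _ _ _ KP) (z_Phi_ux _ _ _ KP)).
    exact: mxfir_cstr.
  exact: mxfir_addr1.
(* The cycle ii, iii, v, iv, ii is now closed. *)
by split=> //; split; auto.
Qed.
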